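(* (Path integral solution.) Let $\lambda>0$ and consider the synchronized soft-policy risk-sensitive stochastic optimal control problem $$\min_{\underline{\pi}}\min_{\underline{\tau}}\ \mathbb{E}_{p_{(\underline{\pi},\underline{\tau})}}\Bigl[\underline{c}_T+\tfrac1\lambda\sum_{t=0}^{T-1}\log\tfrac{\pi_t}{\rho_t}+\tfrac1\lambda\sum_{t=0}^{T-1}\log\tfrac{\tau_t}{\iota_t}\Bigr]$$ with optimal value functions $V_t$ and optimal policy $\pi_t^*$. Let $z_t:=e^{-\lambda V_t}$ and $r_t:=e^{-\lambda c_t}$. Then, for $t=0,\dots,T-1$, $$z_t=\mathbb{E}_{p_{(\underline{\rho}_t,\underline{\iota}_t\mid x_t)}}\Bigl[e^{-\lambda\left(\sum_{k=t}^{T-1}c_k+c_T\right)}\Bigr],$$ where $p_{(\underline{\rho}_t,\underline{\iota}_t\mid x_t)}$ is the trajectory distribution under the baseline policies and transitions $(\rho_k,\iota_k)_{k=t}^{T-1}$ from time $t$ onward, conditioned on $x_t$; and the optimal policy is $$\pi_t^*=\rho_t\,\frac{r_t\,\mathbb{E}_{\iota_t}[z_{t+1}]}{z_t}.$$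
   Context: Setting: a discrete-time controlled stochastic system with finite horizon $T$, states $x_t$, actions $u_t$, and trajectories $\underline{\xi}_T=(x_0,u_0,\dots,x_{T-1},u_{T-1},x_T)$. A policy sequence $\underline{\pi}=(\pi_0,\dots,\pi_{T-1})$ consists of conditional distributions $\pi_t(u_t\mid x_t)$; a transition-kernel sequence $\underline{\tau}=(\tau_0,\dots,\tau_{T-1})$ consists of conditional distributions $\tau_t(x_{t+1}\mid x_t,u_t)$. They induce the trajectory distribution $p_{(\underline{\pi},\underline{\tau})}(\underline{\xi}_T)=p(x_0)\prod_{t=0}^{T-1}\pi_t(u_t\mid x_t)\,\tau_t(x_{t+1}\mid x_t,u_t)$, with a fixed initial state distribution $p(x_0)$. The fixed baseline consists of a reference policy sequence $\underline{\rho}=(\rho_t)$ and the system's true transition kernels $\underline{\iota}=(\iota_t)$; decision variables are required to be absolutely continuous with respect to the baseline ($\pi_t\ll\rho_t$, $\tau_t\ll\iota_t$). Costs: $\underline{c}_T(\underline{\xi}_T)=\sum_{t=0}^{T-1}c_t(x_t,u_t)+c_T(x_T)$ with $c_t\ge 0$ and $c_T\ge 0$. Standing assumption: all trajectory expectations and risk operators that appear are finite for the policies and transitions considered. Notation: $\mathbb{D}^{\mu}_{\sigma}=\mathbb{E}_\mu[\log\frac{\mu}{\sigma}]$ is the Kullback-Leibler divergence, taken conditionally for kernels. $\mathbb{E}_{\iota_t}$ denotes expectation over $x_{t+1}\sim\iota_t(\cdot\mid x_t,u_t)$. $r_t$ is a function of $(x_t,u_t)$; $V_t$, $z_t$ are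 functions of $x_t$. Optimal value function: $V_T=c_T$ and, for $t<T$, $V_t(x_t)$ is the minimum over $(\pi_k,\tau_k)_{k=t}^{T-1}$ of $\mathbb{E}\bigl[c_T+\sum_{k=t}^{T-1}\bigl(c_k+\frac1\lambda\mathbb{D}^{\pi_k}_{\rho_k}+\frac1\lambda\mathbb{D}^{\tau_k}_{\iota_k}\bigr)\bigr]$ over the trajectory segment from $t$ to $T$ generated by $(\pi_k,\tau_k)_{k\ge t}$ given $x_t$. The optimal policy $\pi_t^*$ is the stage-$t$ minimiser $\pi_t^*=\arg\min_{\pi_t}\{\mathbb{E}_{\pi_t}[Q_t]+\frac1\lambda\mathbb{D}^{\pi_t}_{\rho_t}\}$, where $Q_t(x_t,u_t)=\min_{\tau_t}\{\mathbb{E}_{\tau_t}[c_t+V_{t+1}]+\frac1\lambda\mathbb{D}^{\tau_t}_{\iota_t}\}$. *)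

(* Defs.v *)
From HB Require Import structures.
From mathcomp Require Import all_boot all_order all_algebra.
From mathcomp Require Import all_classical all_reals all_analysis.
From mathcomp Require Import measurable_realfun.

Set Implicit Arguments.
Unset Strict Implicit.
Unset Printing Implicit Defensive.

Import Order.TTheory GRing.Theory Num.Theory.
Import numFieldNormedType.Exports.

Local Open Scope classical_set_scope.
Local Open Scope ring_scope.
Local Open Scope ereal_scope.

(** * Probability kernels *)

(* A row of a probability kernel as an element of [probability Y R]; the library
   only types it as a measure. *)
Section kernel_row.
Context d d' (X : measurableType d) (Y : measurableType d') (R : realType).
Variables (k : R.-pker X ~> Y) (x : X).

Definition krow_fun : set Y -> \bar R := k x.

HB.instance Definition _ := Measure.on krow_fun.

Let krow_setT : krow_fun setT = 1.
Proof. exact: prob_kernel. Qed.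

HB.instance Definition _ := Measure_isProbability.Build _ _ _ krow_fun krow_setT.

Definition krow : probability Y R := krow_fun.

End kernel_row.

Section kernel_comap.
Context d0 d1 d2 (W : measurableType d0) (X : measurableType d1)
  (Y : measurableType d2) (R : realType).
Variables (k : R.-pker X ~> Y) (f : W -> X).

Definition kcomap of measurable_fun setT f : W -> {measure set Y -> \bar R} :=
  fun w => k (f w).

Hypothesis mf : measurable_fun setT f.

Let kcomap_measurable A : measurable A ->
  measurable_fun [set: W] (fun w => kcomap mf w A).
Proof.
by move=> mA; exact: (measurableT_comp (measurable_kernel k A mA) mf).
Qed.

HB.instance Definition _ := isKernel.Build _ _ _ _ _ (kcomap mf)
  kcomap_measurable.

Let kcomap_setT w : kcomap mf w setT = 1.
Proof. exact: prob_kernel. Qed.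

HB.instance Definition _ := Kernel_isProbability.Build _ _ _ _ _ (kcomap mf)
  kcomap_setT.

End kernel_comap.

(* The library's composition [mkcomp l k], i.e.
   x |-> \int[l x]_y k (x, y) _, of two probability kernels, bundled as a
   probability kernel. *)
Section kernel_bind.
Context d1 d2 d3 (X : measurableType d1) (Y : measurableType d2)
  (Z : measurableType d3) (R : realType).
Variables (l : R.-pker X ~> Y) (k : R.-pker (X * Y)%type ~> Z).

Definition kbind : X -> {measure set Z -> \bar R} := mkcomp l k.

HB.instance Definition _ := isKernel.Build _ _ _ _ _ kbind
  (measurable_fun_mkcomp_sfinite l k).

Let kbind_setT x : kbind x setT = 1.
Proof.
rewrite /kbind/= /kcomp; under eq_integral do rewrite prob_kernel.
by rewrite integral_cst// mul1e prob_kernel.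
Qed.

HB.instance Definition _ := Kernel_isProbability.Build _ _ _ _ _ kbind
  kbind_setT.

End kernel_bind.

(** * Relative entropy and entropy-regularised minimisation *)

Section relative_entropy.
Context d (Y : measurableType d) (R : realType).
Implicit Types (mu nu : probability Y R) (C : Y -> \bar R).

(* The library's Radon-Nikodym derivative is a junk value when [mu `<< nu] fails,
   hence the explicit case. *)
Definition KL mu nu : \bar R :=
  if `[< mu `<< nu >] then
    \int[mu]_y lne (Radon_Nikodym (charge_of_finite_measure mu) nu y)
  else +oo.

Definition reg_feasible C nu mu : Prop :=
  [/\ mu `<< nu, mu.-integrable setT C & KL mu nu < +oo].

Definition reg_cost (lam : R) C nu mu : \bar R :=
  \int[mu]_y C y + (lam^-1)%:E * KL mu nu.

Definition reg_costs (lam : R) C nu : set (\bar R) :=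
  [set reg_cost lam C nu mu | mu in reg_feasible C nu].

Definition reg_argmin (lam : R) C nu mu : Prop :=
  reg_feasible C nu mu /\
  forall mu', reg_feasible C nu mu' -> reg_cost lam C nu mu <= reg_cost lam C nu mu'.

End relative_entropy.

(** * Trajectories *)

Section trajectories.
Context dX dU (X : measurableType dX) (U : measurableType dU) (R : realType).

(* Sequences indexed by time; only the entries at times t < T matter for a
   problem of horizon T. *)
Definition policies := nat -> R.-pker X ~> U.
Definition transitions := nat -> R.-pker (X * U)%type ~> X.

(* A trajectory segment of n steps started at a given x_t is the tuple
   ((u_t, x_{t+1}), ..., (u_{t+n-1}, x_{t+n})). [state x w k] is x_{t+k} for
   k <= n, where x is x_t, and [action w k] is u_{t+k} for k < n. *)
Definition state (x : X) n (w : n.-tuple (U * X)%type) (k : nat) : X :=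
  nth x (x :: [seq p.2 | p <- w]) k.

Definition action n (w : n.-tuple (U * X)%type) (k : 'I_n) : U := (tnth w k).1.

Definition traj_cons n (q : (X * U) * X * n.-tuple (U * X)%type) :
  n.+1.-tuple (U * X)%type := [tuple of (q.1.1.2, q.1.2) :: q.2].

Lemma measurable_traj_cons n : measurable_fun setT (@traj_cons n).
Proof.
apply: measurable_cons => //.
apply/measurable_fun_pairP; split => /=.
  rewrite [X in measurable_fun _ X](_ : _ = snd \o (fst \o fst))//.
  by apply: measurableT_comp => //; exact: measurableT_comp.
rewrite [X in measurable_fun _ X](_ : _ = snd \o fst)//.
exact: measurableT_comp.
Qed.

(* Law, given x_t, of the n-step segment from time t: draw u_t ~ pi_t(x_t), then
   x_{t+1} ~ tau_t(x_t, u_t), then the remaining n - 1 steps from x_{t+1}. *)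
Fixpoint traj (pi : policies) (tau : transitions) (t n : nat) :
    R.-pker X ~> (n.-tuple (U * X)%type) :=
  if n is n'.+1 then
    kbind (pi t) (kbind (tau t)
      (kbind (kcomap (traj pi tau t.+1 n') (@measurable_snd _ _ (X * U)%type X))
             (kdirac (@measurable_traj_cons n'))))
  else kdirac (measurable_cst ([tuple] : 0.-tuple (U * X)%type)).

End trajectories.

(** * The soft-policy risk-sensitive control problem *)

Section control.
Context dX dU (X : measurableType dX) (U : measurableType dU) (R : realType).
Variables (T : nat) (lam : R) (c : nat -> X * U -> R) (cT : X -> R).
Variables (rho : policies X U R) (iota : transitions X U R).

(* c_t + ... + c_{T-1} + c_T along the n-step segment w from time t, n = T - t. *)
Definition path_cost (t n : nat) (x : X) (w : n.-tuple (U * X)%type) : R :=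
  (\sum_(k < n) c (t + k)%N (state x w k, action w k) + cT (state x w n))%R.

Definition reg_path_cost (pi : policies X U R) (tau : transitions X U R)
    (t n : nat) (x : X) (w : n.-tuple (U * X)%type) : \bar R :=
  (cT (state x w n))%:E +
  \sum_(k < n)
    let xk := state x w k in let uk := action w k in
    ((c (t + k)%N (xk, uk))%:E
     + (lam^-1)%:E * KL (krow (pi (t + k)%N) xk) (krow (rho (t + k)%N) xk)
     + (lam^-1)%:E *
         KL (krow (tau (t + k)%N) (xk, uk)) (krow (iota (t + k)%N) (xk, uk))).

Definition control_feasible (t : nat) (x : X) (pi : policies X U R)
    (tau : transitions X U R) : Prop :=
  [/\ forall k y, (t <= k < T)%N -> pi k y `<< rho k y,
      forall k p, (t <= k < T)%N -> tau k p `<< iota k p &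
      (traj pi tau t (T - t) x).-integrable setT
        (@reg_path_cost pi tau t (T - t) x)].

Definition control_cost (t : nat) (x : X) (pi : policies X U R)
    (tau : transitions X U R) : \bar R :=
  \int[traj pi tau t (T - t) x]_w reg_path_cost pi tau t x w.

Definition control_costs (t : nat) (x : X) : set (\bar R) :=
  [set v | exists pi tau,
    control_feasible t x pi tau /\ v = control_cost t x pi tau].

Definition value (t : nat) (x : X) : \bar R :=
  if (t < T)%N then ereal_inf (control_costs t x) else (cT x)%:E.

Definition zfun (t : nat) (x : X) : \bar R := expeR (- (lam%:E * value t x)).

Definition rfun (t : nat) (p : X * U) : R := expR (- (lam * c t p)).

(* Objective of the minimisation over tau_t that defines Q_t(x_t, u_t). *)
Definition next_cost (t : nat) (p : X * U) (y : X) : \bar R :=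
  (c t p)%:E + value t.+1 y.

Definition Qfun (t : nat) (p : X * U) : \bar R :=
  ereal_inf (reg_costs lam (next_cost t p) (krow (iota t) p)).

Definition optimal_policy (t : nat) (pi : R.-pker X ~> U) : Prop :=
  forall x, reg_argmin lam (fun u => Qfun t (x, u)) (krow (rho t) x) (krow pi x).

End control.

(* Main.v *)
Require Import Defs.
From HB Require Import structures.
From mathcomp Require Import all_boot all_order all_algebra.
From mathcomp Require Import all_classical all_reals all_analysis.
From mathcomp Require Import measurable_realfun.
From mathcomp Require Import lra.

Set Implicit Arguments.
Unset Strict Implicit.
Unset Printing Implicit Defensive.

Import Order.TTheory GRing.Theory Num.Theory.
Import numFieldNormedType.Exports.

Local Open Scope classical_set_scope.
Local Open Scope ring_scope.
Local Open Scope ereal_scope.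

(** Everything rests on the Gibbs variational principle: for a probability nu
    and a cost C >= 0, the minimum over mu of E_mu[C] + KL(mu, nu) / lam is
    the free energy F = - log E_nu[exp(- lam C)] / lam, and it is attained
    exactly at the Gibbs measure of density exp(lam (F - C)) with respect to
    nu. If f is the density of mu and q = exp(lam (F - C)) / f, then E_mu[q]
    <= 1, and integrating log q <= q - 1 against mu gives the inequality;
    equality forces q = 1 mu-almost everywhere, hence identifies mu
    ([free_energy_le], [gibbs_optimal], [gibbs_unique]).

    The control problem is a nest of such minimisations. Define [soft_value]
    by backward recursion, taking one free energy over the next state and one
    over the action at each stage.

    - In the exponential scale exp(- lam F) = E_nu[exp(- lam C)], so the
      recursion becomes linear and unrolls into an expectation over baseline
      trajectories: this is the path integral formula
      ([soft_value_path_integral]).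
    - No pair of policies and transitions does better than [soft_value]: the
      cost of a trajectory splits into its first stage and the rest
      ([expected_costS]), and each stage is bounded below by the variational
      principle ([soft_value_le]).
    - The Gibbs kernels of the stage problems attain it ([expected_cost_opt]),
      because a Gibbs density depends measurably on the state.

    So [soft_value] is the optimal value function ([valueE]). The formula for
    the optimal policy is the Gibbs density of the last free energy, and
    uniqueness in the variational principle makes it hold for every optimal
    policy ([optimal_policyE]).

    One point of measure theory shapes the lower bound. On general measurable
    spaces the divergence between the rows of two kernels need not depend
    measurably on the row; only the total cost of a trajectory is assumed
    measurable. The trajectory is therefore disintegrated one stage at a
    time: once x_t and u_t are fixed, the divergences of that stage are
    constants, and either one of them is infinite, in which case the bound is
    trivial, or they can be subtracted, in which case the remaining cost is
    measurable again ([measurable_reg_path_cost_tail]). *)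

(** * Densities and relative entropy *)

Section density.
Context d (Y : measurableType d) (R : realType).
Implicit Types (mu nu : probability Y R) (f : Y -> R) (g : Y -> \bar R).

Definition is_density mu nu f : Prop :=
  [/\ measurable_fun setT f, forall y, (0 <= f y)%R &
      forall A, measurable A -> mu A = \int[nu]_(y in A) (f y)%:E].

(** [Radon_Nikodym] is the derivative of a signed charge, whose sign is
    controlled only almost everywhere; the version for finite measures is
    nonnegative and finite at each point, so it can be taken real valued. *)
Lemma density_exists mu nu : mu `<< nu -> exists f, is_density mu nu f.
Proof.
move=> munu; pose h := Radon_Nikodym_SigmaFinite.f mu nu.
have hfin y : h y \is a fin_num by exact: Radon_Nikodym_SigmaFinite.f_fin_num.
have mh : measurable_fun setT h.
  exact: measurable_int (Radon_Nikodym_SigmaFinite.f_integrable munu).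
exists (fine \o h); split.
- exact: measurableT_comp.
- by move=> y; rewrite fine_ge0// Radon_Nikodym_SigmaFinite.f_ge0.
- move=> A mA; under eq_integral do rewrite fineK//.
  exact: Radon_Nikodym_SigmaFinite.f_integral.
Qed.

Lemma density_dominates mu nu f : is_density mu nu f -> mu `<< nu.
Proof.
case=> mf f0 muE; apply/null_content_dominatesP => A mA nuA.
rewrite muE// null_set_integral//.
exact/measurable_EFinP/measurable_funTS.
Qed.

Lemma density_ae mu nu f : is_density mu nu f ->
  ae_eq nu setT (Radon_Nikodym_SigmaFinite.f mu nu) (EFin \o f).
Proof.
move=> fd; have munu := density_dominates fd; case: fd => mf f0 muE.
apply: integral_ae_eq => //.
- exact: Radon_Nikodym_SigmaFinite.f_integrable.
- exact/measurable_EFinP.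
- move=> A _ mA; rewrite -[RHS]muE//.
  exact/esym/Radon_Nikodym_SigmaFinite.f_integral.
Qed.

Lemma density_integral mu nu f g A : is_density mu nu f -> measurable A ->
  measurable_fun A g -> (forall y, 0 <= g y) ->
  \int[mu]_(y in A) g y = \int[nu]_(y in A) (g y * (f y)%:E).
Proof.
move=> fd mA mg g0; have munu := density_dominates fd.
rewrite -(Radon_Nikodym_SigmaFinite.change_of_variables munu)//.
have := density_ae fd; case: fd => mf f0 _ fE.
apply: ge0_ae_eq_integral => //.
- apply: emeasurable_funM => //; apply: measurable_funTS.
  exact: measurable_int (Radon_Nikodym_SigmaFinite.f_integrable munu).
- by apply: emeasurable_funM => //; apply/measurable_EFinP/measurable_funTS.
- by move=> y _; rewrite mule_ge0// Radon_Nikodym_SigmaFinite.f_ge0.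
- by move=> y _; rewrite mule_ge0// lee_fin.
- by apply: ae_eqe_mul2l; apply: ae_eq_subset fE.
Qed.

(** The mu-measure of the set where f vanishes is the integral of f over it. *)
Lemma density_gt0 mu nu f : is_density mu nu f ->
  {ae mu, forall y, (0 < f y)%R}.
Proof.
case=> mf f0 muE.
have m0 : measurable [set y | (f y <= 0)%R].
  rewrite (_ : [set y | _] = [set: Y] `&` f @^-1` `]-oo, 0%R]); first exact: mf.
  by rewrite setTI; apply/seteqP; split => y /=; rewrite in_itv.
exists [set y | (f y <= 0)%R]; split => //=.
- rewrite muE// integral0_eq// => y /= fy0.
  by congr (_%:E); apply/eqP; rewrite eq_le fy0 f0.
- by move=> y /= /negP; rewrite -leNgt.
Qed.

(** Relative entropy can be computed from any density, which makes it
    explicit for the measures that are constructed from one. The points where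
    f vanishes, at which [ln] and [lne] disagree, form a mu-null set. *)
Lemma KL_density mu nu f : is_density mu nu f ->
  KL mu nu = \int[mu]_y (ln (f y))%:E.
Proof.
move=> fd; have munu := density_dominates fd.
rewrite /KL; case: asboolP => // _.
set h := Radon_Nikodym _ _.
have hfin y : h y \is a fin_num by exact: Radon_Nikodym_fin_num.
have mh : measurable_fun setT h.
  by apply: (measurable_int nu); exact: Radon_Nikodym_integrable.
have := density_gt0 fd; have := density_ae fd; case: (fd) => mf f0 muE fE f_gt0.
apply: ae_eq_integral => //.
- have -> : (fun y => lne (h y)) =
      (fun y => if (fine (h y) <= 0)%R then -oo else (ln (fine (h y)))%:E).
    by apply/funext => y; rewrite -[in LHS](fineK (hfin y)).
  apply: measurable_fun_ifT => //.
    by apply: measurable_fun_ler => //; exact: measurableT_comp.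
  by apply/measurable_EFinP; do 2 apply: measurableT_comp => //.
- by apply/measurable_EFinP; apply: measurableT_comp.
- have hE : ae_eq mu setT h (EFin \o f).
    apply: (null_dominates_ae_eq measurableT munu).
    apply: ae_eq_trans fE; apply: ae_eq_sym.
    exact: ae_eq_Radon_Nikodym_SigmaFinite.
  apply: filterS2 hE f_gt0 => y hy fy _.
  by rewrite hy//; exact: lne_EFin.
Qed.

End density.

(** * Free energy *)

Section free_energy.
Context d (Y : measurableType d) (R : realType).
Variables (lam : R) (nu : probability Y R) (C : Y -> R).
Hypotheses (lam_gt0 : (0 < lam)%R) (mC : measurable_fun setT C)
  (C_ge0 : forall y, (0 <= C y)%R).

Definition free_energy : R :=
  (- (lam^-1 * ln (fine (\int[nu]_y (expR (- (lam * C y)))%:E))))%R.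

Lemma measurable_expRN : measurable_fun setT (fun y => expR (- (lam * C y))).
Proof.
apply: measurableT_comp => //; apply: measurable_funN.
exact: measurable_funM.
Qed.

Lemma integral_expR_gt0 : 0 < \int[nu]_y (expR (- (lam * C y)))%:E.
Proof.
rewrite lt_neqAle; apply/andP; split; last first.
  by apply: integral_ge0 => y _; rewrite lee_fin expR_ge0.
apply/eqP => I0.
have : \int[nu]_y `|(expR (- (lam * C y)))%:E| = 0.
  rewrite [RHS]I0; apply: eq_integral => y _.
  by rewrite gee0_abs ?lee_fin ?expR_ge0.
move/ae_eq_integral_abs => /(_ measurableT).
have mE : measurable_fun setT (fun y => (expR (- (lam * C y)))%:E).
  exact/measurable_EFinP/measurable_expRN.
move=> /(_ mE) [N [mN N0 sub]].
have NT : N = setT.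
  apply/seteqP; split => // y _; apply: sub => /= /(_ I) /eqP.
  by rewrite eqe; apply/negP; rewrite gt_eqF ?expR_gt0.
have := probability_setT nu; rewrite -NT => /(etrans (esym N0))/eqP.
by rewrite eq_sym onee_eq0.
Qed.

Lemma integral_expR_le1 : \int[nu]_y (expR (- (lam * C y)))%:E <= 1.
Proof.
rewrite -(@probability_setT _ _ _ nu) -[leRHS]mul1e -integral_cst//.
apply: ge0_le_integral => //.
- exact/measurable_EFinP/measurable_expRN.
- move=> y _; rewrite lee_fin -[leRHS]expR0 ler_expR oppr_le0.
  by rewrite mulr_ge0// ltW.
Qed.

(** C >= 0 keeps the integral in ]0, 1], so that its logarithm is genuine. *)
Lemma expR_free_energy :
  (expR (- (lam * free_energy)))%:E = \int[nu]_y (expR (- (lam * C y)))%:E.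
Proof.
have I0 := integral_expR_gt0.
have Ifin : \int[nu]_y (expR (- (lam * C y)))%:E \is a fin_num.
  rewrite ge0_fin_numE ?ltW//; apply: le_lt_trans integral_expR_le1 _.
  exact: ltry.
rewrite /free_energy mulrN opprK mulVKf ?gt_eqF// lnK ?fineK//.
by rewrite posrE fine_gt0// I0 ltey_eq Ifin.
Qed.

Lemma free_energy_ge0 : (0 <= free_energy)%R.
Proof.
have := integral_expR_le1; rewrite -expR_free_energy lee_fin -[leRHS]expR0.
by rewrite ler_expR oppr_le0 pmulr_rge0.
Qed.

Definition gibbs_density (y : Y) : R := expR (lam * (free_energy - C y)).

Lemma gibbs_densityE y : gibbs_density y =
  (expR (lam * free_energy) * expR (- (lam * C y)))%R.
Proof. by rewrite -expRD /gibbs_density mulrBr. Qed.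

Lemma measurable_gibbs_density : measurable_fun setT gibbs_density.
Proof.
apply: measurableT_comp => //; apply: measurable_funM => //.
exact: measurable_funB.
Qed.

Lemma integral_gibbs_density : \int[nu]_y (gibbs_density y)%:E = 1.
Proof.
under eq_integral do rewrite gibbs_densityE EFinM.
rewrite ge0_integralZl//=.
- by rewrite -expR_free_energy -EFinM -expRD subrr expR0.
- exact/measurable_EFinP/measurable_expRN.
Qed.

Section variational.
Variables (mu : probability Y R) (f : Y -> R).
Hypothesis fd : is_density mu nu f.

(** Quotient of the Gibbs density by f. It is written with [ln (f y)], which
    is 0 where f vanishes, so as to be positive and measurable everywhere. *)
Definition gibbs_ratio y := expR (lam * (free_energy - C y) - ln (f y)).

Let mf : measurable_fun setT f. Proof. by case: fd. Qed.
Let mlnf : measurable_fun setT (fun y => ln (f y)).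
Proof. exact: measurableT_comp. Qed.

Let mexpo : measurable_fun setT
  (fun y => (lam * (free_energy - C y) - ln (f y))%R).
Proof.
apply: measurable_funB => //; apply: measurable_funM => //.
exact: measurable_funB.
Qed.

Lemma measurable_gibbs_ratio : measurable_fun setT gibbs_ratio.
Proof. exact: measurableT_comp. Qed.

(** Passing from mu to nu multiplies the ratio by f, which gives the Gibbs
    density where f > 0 and 0 elsewhere. *)
Lemma integral_gibbs_ratio_le A : measurable A ->
  \int[mu]_(y in A) (gibbs_ratio y)%:E <=
  \int[nu]_(y in A) (gibbs_density y)%:E.
Proof.
move=> mA; have mr := measurable_gibbs_ratio.
have f0 : forall y, (0 <= f y)%R by case: fd.
rewrite (density_integral fd)//; last 2 first.
- exact/measurable_EFinP/measurable_funTS.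
- by move=> y; rewrite lee_fin expR_ge0.
apply: ge0_le_integral => //.
- by move=> y _; rewrite -EFinM lee_fin mulr_ge0// expR_ge0.
- apply: emeasurable_funM; apply/measurable_EFinP/measurable_funTS => //.
- exact/measurable_EFinP/measurable_funTS/measurable_gibbs_density.
- move=> y _; rewrite -EFinM lee_fin /gibbs_ratio /gibbs_density.
  have := f0 y; rewrite le_eqVlt => /predU1P[<-|fy0].
    by rewrite mulr0 expR_ge0.
  by rewrite expRD expRN lnK ?posrE// divfK ?gt_eqF.
Qed.

Lemma integral_gibbs_ratio_le1 : \int[mu]_y (gibbs_ratio y)%:E <= 1.
Proof.
by rewrite -integral_gibbs_density; exact: integral_gibbs_ratio_le.
Qed.

Lemma integrable_gibbs_ratio : mu.-integrable setT (EFin \o gibbs_ratio).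
Proof.
apply/integrableP; split; first exact/measurable_EFinP/measurable_gibbs_ratio.
apply: le_lt_trans (ltry 1); apply: le_trans integral_gibbs_ratio_le1.
rewrite le_eqVlt; apply/predU1P; left.
by apply: eq_integral => y _; rewrite gee0_abs// lee_fin expR_ge0.
Qed.

(** The defect q - 1 - log q of the logarithmic inequality at the ratio q. *)
Definition gibbs_gap y :=
  (gibbs_ratio y - 1 - (lam * (free_energy - C y) - ln (f y)))%R.

Lemma gibbs_gap_ge0 y : (0 <= gibbs_gap y)%R.
Proof. by rewrite subr_ge0 lerBrDl expR_ge1Dx. Qed.

Lemma gibbs_gap_eq0 y : gibbs_gap y = 0%R -> gibbs_ratio y = 1%R.
Proof.
rewrite /gibbs_gap /gibbs_ratio; set e := (_ - ln _)%R => /eqP.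
have [->|/expR_gt1Dx e0] := eqVneq e 0%R; first by rewrite expR0.
by rewrite subr_eq0 => /eqP E; lra.
Qed.

Lemma measurable_gibbs_gap : measurable_fun setT gibbs_gap.
Proof.
apply: measurable_funB => //; apply: measurable_funB => //.
exact: measurable_gibbs_ratio.
Qed.

Hypotheses (intC : mu.-integrable setT (EFin \o C)) (KLoo : KL mu nu < +oo).

(** Nonnegativity of the gap bounds log f from below by an integrable
    function, so that only its positive part could fail to be integrable;
    finiteness of the relative entropy excludes this. *)
Lemma integrable_log_density : mu.-integrable setT (fun y => (ln (f y))%:E).
Proof.
pose g y := (ln (f y))%:E.
have mg : measurable_fun setT g by exact/measurable_EFinP.
(* b dominates the negative part of log f. *)
pose b y := (`|1 + lam * free_energy| + gibbs_ratio y + lam * C y)%R.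
have b0 y : (0 <= b y)%R.
  by rewrite /b !addr_ge0// ?expR_ge0// mulr_ge0// ltW.
have intb : mu.-integrable setT (EFin \o b).
  have -> : EFin \o b = (cst (`|1 + lam * free_energy|)%:E \+
      (EFin \o gibbs_ratio)) \+ (fun y => lam%:E * (C y)%:E) by [].
  apply: integrableD => //; last exact: integrableZl.
  apply: integrableD => //; last exact: integrable_gibbs_ratio.
  exact: finite_measure_integrable_cst.
have gneg : \int[mu]_y g^\- y < +oo.
  apply: (@le_lt_trans _ _ (\int[mu]_y (b y)%:E)); last exact: integrable_lty.
  apply: ge0_le_integral => //.
  - exact: measurable_funeneg.
  - by apply: (measurable_int mu).
  - move=> y _; rewrite funenegE /g/= -EFin_max lee_fin ge_max b0 andbT.
    have := gibbs_gap_ge0 y; rewrite /gibbs_gap /b.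
    have := ler_norm (- (1 + lam * free_energy))%R; rewrite normrN; lra.
have gpos : \int[mu]_y g^\+ y < +oo.
  move: KLoo; rewrite (KL_density fd) integralE -/g.
  have : \int[mu]_y g^\- y \is a fin_num.
    by rewrite ge0_fin_numE//; apply: integral_ge0.
  set a := integral _ _ g^\-; set b' := integral _ _ g^\+.
  by move=> /fineK <-; case: b' => [r'| |]; rewrite ?ltry ?ltNyr ?ltNye.
apply/integrableP; split => //.
under eq_integral do rewrite -/(g _) -/((abse \o g) _) fune_abse.
rewrite ge0_integralD//; first exact: lte_add_pinfty.
- exact: measurable_funepos.
- exact: measurable_funeneg.
Qed.

Lemma integrable_gibbs_gap : mu.-integrable setT (EFin \o gibbs_gap).
Proof.
have -> : EFin \o gibbs_gap = ((EFin \o gibbs_ratio) \+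
    (fun y => (ln (f y))%:E)) \+
    ((fun y => lam%:E * (C y)%:E) \+ cst (- (1 + lam * free_energy))%:E).
  apply/funext => y /=; rewrite -!EFinM -!EFinD; congr EFin.
  by rewrite /gibbs_gap; lra.
apply: integrableD => //; apply: integrableD => //.
- exact: integrable_gibbs_ratio.
- exact: integrable_log_density.
- exact: integrableZl.
- exact: finite_measure_integrable_cst.
Qed.

(** Integrated form of the definition of the gap. All terms being finite,
    both the variational inequality and its equality case can be read off
    from it. *)
Lemma gibbs_identity :
  lam%:E * \int[mu]_y (C y)%:E + KL mu nu + \int[mu]_y (gibbs_ratio y)%:E =
  (1 + lam * free_energy)%:E + \int[mu]_y (gibbs_gap y)%:E.
Proof.
rewrite (KL_density fd) -integralZl// -integralD//; last 2 first.
- exact: integrableZl.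
- exact: integrable_log_density.
rewrite -integralD//; last 2 first.
- apply: integrableD => //; first exact: integrableZl.
  exact: integrable_log_density.
- exact: integrable_gibbs_ratio.
rewrite -[X in X + _]mule1 -(@probability_setT _ _ _ mu) -integral_cst//.
rewrite -integralD//; last 2 first.
- exact: finite_measure_integrable_cst.
- exact: integrable_gibbs_gap.
apply: eq_integral => y _; rewrite /= -EFinM -!EFinD; congr EFin.
rewrite /gibbs_gap; lra.
Qed.

End variational.
End free_energy.

Lemma free_energy0 d (Y : measurableType d) (R : realType) (lam : R)
  (nu : probability Y R) : free_energy lam nu (cst 0%R) = 0%R.
Proof.
rewrite /free_energy; under eq_integral do rewrite /= mulr0 oppr0 expR0.
by rewrite integral_cst//= probability_setT mule1 /= ln1 mulr0 oppr0.
Qed.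

(** Gibbs' inequality is the variational principle for the zero cost. *)
Lemma KL_ge0 d (Y : measurableType d) (R : realType) (mu nu : probability Y R) :
  0 <= KL mu nu.
Proof.
have [Loo|] := ltP (KL mu nu) +oo; last by apply: le_trans; exact: leey.
have munu : mu `<< nu by move: Loo; rewrite /KL; case: asboolP; rewrite ?ltxx.
have [f fd] := density_exists munu.
pose C0 : Y -> R := cst 0%R.
have mC0 : measurable_fun setT C0 by [].
have C0_ge0 y : (0 <= C0 y)%R by [].
have iC0 : mu.-integrable setT (EFin \o C0).
  exact: finite_measure_integrable_cst.
have := gibbs_identity ltr01 mC0 C0_ge0 fd iC0 Loo.
rewrite free_energy0 integral0 mule0 add0e mulr0 addr0.
have := integral_gibbs_ratio_le1 ltr01 mC0 C0_ge0 fd.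
set r := integral _ _ _ => r1 E.
have : 0 + 1 <= KL mu nu + 1.
  apply: (@le_trans _ _ (KL mu nu + r)); last by rewrite leeD2l.
  rewrite E add0e leeDl//; apply: integral_ge0 => y _.
  by rewrite lee_fin gibbs_gap_ge0.
by rewrite leeD2rE.
Qed.

(** * The Gibbs variational principle *)

Section gibbs_principle.
Context d (Y : measurableType d) (R : realType).
Variables (lam : R) (nu : probability Y R) (C : Y -> R).
Hypotheses (lam_gt0 : (0 < lam)%R) (mC : measurable_fun setT C)
  (C_ge0 : forall y, (0 <= C y)%R).
Implicit Types mu : probability Y R.

Let intC_ge0 mu : 0 <= \int[mu]_y (C y)%:E.
Proof. by apply: integral_ge0 => y _; rewrite lee_fin. Qed.

Let integrableC mu : \int[mu]_y (C y)%:E < +oo ->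
  mu.-integrable setT (EFin \o C).
Proof.
move=> Coo; apply/integrableP; split; first exact/measurable_EFinP.
by under eq_integral do rewrite /= ger0_norm//.
Qed.

Let KL_lt_dom mu : KL mu nu < +oo -> mu `<< nu.
Proof. by rewrite /KL; case: asboolP; rewrite ?ltxx. Qed.

Let F := free_energy lam nu C.

Let gibbs_identity' mu f : is_density mu nu f -> KL mu nu < +oo ->
  mu.-integrable setT (EFin \o C) ->
  lam%:E * (\int[mu]_y (C y)%:E + (lam^-1)%:E * KL mu nu)
    + \int[mu]_y (gibbs_ratio lam nu C f y)%:E =
  (1 + lam * F)%:E + \int[mu]_y (gibbs_gap lam nu C f y)%:E.
Proof.
move=> fd Loo iC; rewrite -gibbs_identity//.
congr (_ + _); rewrite muleDr//; last first.
  rewrite ge0_adde_def// inE//; apply: mule_ge0; rewrite ?KL_ge0//.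
  by rewrite lee_fin invr_ge0 ltW.
by rewrite muleA -EFinM mulfV ?gt_eqF// mul1e.
Qed.

(** Stated for every mu, including those of infinite cost, since the backward
    induction below compares with policies of which nothing is known. *)
Lemma free_energy_le mu :
  F%:E <= \int[mu]_y (C y)%:E + (lam^-1)%:E * KL mu nu.
Proof.
have li0 : (0 < lam^-1)%R by rewrite invr_gt0.
have [Loo|] := ltP (KL mu nu) +oo; last first.
  rewrite leye_eq => /eqP ->; rewrite gt0_muley ?lte_fin// addey ?leey//.
  by rewrite -ltNye (lt_le_trans _ (intC_ge0 mu)).
have [Coo|] := ltP (\int[mu]_y (C y)%:E) +oo; last first.
  rewrite leye_eq => /eqP ->; rewrite addye ?leey//.
  rewrite -ltNye (@lt_le_trans _ _ 0)//.
  by apply: mule_ge0; rewrite ?KL_ge0// lee_fin ltW.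
have [f fd] := density_exists (KL_lt_dom Loo).
have := gibbs_identity' fd Loo (integrableC Coo).
set G := (X in lam%:E * X) => E.
have : (1 + lam * F)%:E <= lam%:E * G + 1.
  apply: (@le_trans _ _ (lam%:E * G +
      \int[mu]_y (gibbs_ratio lam nu C f y)%:E)).
    rewrite E leeDl//; apply: integral_ge0 => y _.
    by rewrite lee_fin gibbs_gap_ge0.
  by rewrite leeD2l// integral_gibbs_ratio_le1.
by rewrite addrC EFinD leeD2rE// EFinM lee_pmul2l// lte_fin.
Qed.

(** Equality in the variational inequality makes the gap vanish, so the ratio
    is 1 mu-almost everywhere; hence mu is below the Gibbs measure on every
    set, and two probabilities so ordered are equal, by comparison on
    complements. *)
Lemma gibbs_unique mu : reg_feasible (EFin \o C) nu mu ->
  \int[mu]_y (C y)%:E + (lam^-1)%:E * KL mu nu <= F%:E ->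
  forall A, measurable A ->
  mu A = \int[nu]_(y in A) (gibbs_density lam nu C y)%:E.
Proof.
move=> [munu iC Loo] le_F.
have [f fd] := density_exists munu.
have := gibbs_identity' fd Loo iC; set G := (X in lam%:E * X) => E.
have r1 := integral_gibbs_ratio_le1 lam_gt0 mC C_ge0 fd.
have mgap : measurable_fun setT (gibbs_gap lam nu C f).
  exact: (measurable_gibbs_gap lam mC fd).
have gap0 : \int[mu]_y (gibbs_gap lam nu C f y)%:E = 0.
  apply/eqP; rewrite eq_le; apply/andP; split; last first.
    by apply: integral_ge0 => y _; rewrite lee_fin gibbs_gap_ge0.
  have : (1 + lam * F)%:E + \int[mu]_y (gibbs_gap lam nu C f y)%:E <=
         (1 + lam * F)%:E + 0.
    rewrite -E adde0 EFinD addeC leeD// EFinM lee_pmul2l//.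
  by rewrite leeD2lE.
have ratio1 : ae_eq mu setT (EFin \o gibbs_ratio lam nu C f) (cst 1).
  have /ae_eq_integral_abs : \int[mu]_y `|(gibbs_gap lam nu C f y)%:E| = 0.
    rewrite -[RHS]gap0; apply: eq_integral => y _.
    by rewrite gee0_abs// lee_fin gibbs_gap_ge0.
  move=> /(_ measurableT) => ae0.
  have {}ae0 := ae0 ((measurable_EFinP _ _).2 mgap).
  by apply: filterS ae0 => y /= + _ => /(_ I) [] /gibbs_gap_eq0 ->.
have mr : measurable_fun setT (gibbs_ratio lam nu C f).
  exact: (measurable_gibbs_ratio lam mC fd).
have le_g A : measurable A ->
    mu A <= \int[nu]_(y in A) (gibbs_density lam nu C y)%:E.
  move=> mA; apply: le_trans (integral_gibbs_ratio_le lam mC fd mA).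
  rewrite -[mu A]mul1e -integral_cst// le_eqVlt; apply/predU1P; left.
  apply: ge0_ae_eq_integral => //.
  - exact/measurable_EFinP/measurable_funTS.
  - by move=> y _; rewrite lee_fin expR_ge0.
  - by apply: filterS ratio1 => y /= + _ => /(_ I) ->.
move=> A mA; apply/eqP; rewrite eq_le le_g//=.
have mg : measurable_fun setT (gibbs_density lam nu C).
  exact: measurable_gibbs_density.
have := le_g _ (measurableC mA).
rewrite probability_setC// => hC.
have : \int[nu]_(y in A) (gibbs_density lam nu C y)%:E +
    \int[nu]_(y in ~` A) (gibbs_density lam nu C y)%:E = 1.
  rewrite -ge0_integral_setU//.
  - by rewrite setUv integral_gibbs_density.
  - exact: measurableC.
  - exact/measurable_EFinP/measurable_funTS.
  - by move=> y _; rewrite lee_fin expR_ge0.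
  - by apply/disj_set2P; exact: setICr.
have muA_fin : mu A \is a fin_num by exact: fin_num_measure.
move: muA_fin hC; set a := integral _ A _; set b := integral _ (~` A) _.
have : 0 <= a by apply: integral_ge0 => y _; rewrite lee_fin expR_ge0.
move=> + /fineK <-.
case: a => [a| |]; case: b => [b| |]//=.
by rewrite -!EFinD !lee_fin => _ + [] => ? ?; lra.
Qed.

(** Boundedness of C exp(- lam C), by 1 / lam. *)
Lemma gibbs_integrable mu :
  (forall A, measurable A ->
    mu A = \int[nu]_(y in A) (gibbs_density lam nu C y)%:E) ->
  mu.-integrable setT (EFin \o C).
Proof.
move=> muE; apply: integrableC.
have mg : measurable_fun setT (gibbs_density lam nu C).
  exact: measurable_gibbs_density.
have fd : is_density mu nu (gibbs_density lam nu C).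
  by split => // y; exact: expR_ge0.
have mCE : measurable_fun setT (EFin \o C) by exact/measurable_EFinP.
rewrite (density_integral fd)//.
apply: (@le_lt_trans _ _ (\int[nu]_y (lam^-1 * expR (lam * F))%:E)); last first.
  rewrite integral_cst// [X in _ * X](_ : _ = 1) ?mule1 ?ltry//.
  exact: probability_setT.
apply: ge0_le_integral => //.
- by move=> y _; rewrite -EFinM lee_fin mulr_ge0// expR_ge0.
- by apply: emeasurable_funM => //; exact/measurable_EFinP.
- move=> y _; rewrite -EFinM lee_fin gibbs_densityE mulrCA mulrC.
  rewrite ler_wpM2r ?expR_ge0// expRN -ler_pdivlMr ?invrK ?invr_gt0 ?expR_gt0//.
  rewrite mulrC -ler_pdivrMr ?invr_gt0// invrK.
  have := expR_ge1Dx (lam * C y); have := mulr_ge0 (ltW lam_gt0) (C_ge0 y); lra.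
Qed.

(** The logarithm of the Gibbs density is affine in C. *)
Lemma gibbs_KL mu :
  (forall A, measurable A ->
    mu A = \int[nu]_(y in A) (gibbs_density lam nu C y)%:E) ->
  KL mu nu = (lam * (F - fine (\int[mu]_y (C y)%:E)))%:E.
Proof.
move=> muE; have iC := gibbs_integrable muE.
have mg : measurable_fun setT (gibbs_density lam nu C).
  exact: measurable_gibbs_density.
have fd : is_density mu nu (gibbs_density lam nu C).
  by split => // y; exact: expR_ge0.
rewrite (KL_density fd).
under eq_integral do rewrite /gibbs_density expRK EFinM EFinB.
rewrite integralZl//; last first.
  by apply: integrableB => //; exact: finite_measure_integrable_cst.
rewrite integralB//; last exact: finite_measure_integrable_cst.
rewrite integral_cst// [X in _ * (_ * X - _)](_ : _ = 1); last first.
  exact: probability_setT.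
by rewrite mule1 EFinM EFinB fineK//; exact: integrable_fin_num.
Qed.

Lemma gibbs_optimal mu :
  (forall A, measurable A ->
    mu A = \int[nu]_(y in A) (gibbs_density lam nu C y)%:E) ->
  reg_feasible (EFin \o C) nu mu /\
  reg_cost lam (EFin \o C) nu mu = F%:E.
Proof.
move=> muE; have iC := gibbs_integrable muE.
have fd : is_density mu nu (gibbs_density lam nu C).
  split => //; first exact: measurable_gibbs_density.
  by move=> y; exact: expR_ge0.
split; first by split; [exact: density_dominates fd| |rewrite gibbs_KL// ltry].
rewrite /reg_cost gibbs_KL// -[X in X + _]fineK; last exact: integrable_fin_num.
by rewrite -EFinM -EFinD mulrA mulVf ?gt_eqF// mul1r addrC subrK.
Qed.

End gibbs_principle.

(** * Gibbs kernels *)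

Lemma krow_integral d d' (X : measurableType d) (Y : measurableType d')
    (R : realType) (k : R.-pker X ~> Y) x (g : Y -> \bar R) A :
  \int[krow k x]_(y in A) g y = \int[k x]_(y in A) g y.
Proof. exact: eq_measure_integral. Qed.

Lemma measurable_free_energy d d' (X : measurableType d)
    (Y : measurableType d') (R : realType) (lam : R) (k : R.-pker X ~> Y)
    (C : X * Y -> R) : measurable_fun setT C ->
  measurable_fun setT (fun x => free_energy lam (krow k x) (fun y => C (x, y))).
Proof.
move=> mC; apply: measurable_funN; apply: measurable_funM => //.
apply: measurableT_comp => //; apply: measurableT_comp => //.
under eq_fun do rewrite krow_integral.
apply: (measurable_fun_integral_finite_kernel
  (fun p => (expR (- (lam * C p)))%:E) k).
- by move=> p; rewrite lee_fin expR_ge0.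
- exact/measurable_EFinP/measurable_expRN.
Qed.

Section gibbs_kernel.
Context d d' (X : measurableType d) (Y : measurableType d') (R : realType).
Variables (lam : R) (k : R.-pker X ~> Y) (C : X * Y -> R).

(** The hypotheses under which these set functions form a probability kernel
    are arguments of the definition, so that the structures can be inferred
    from the term. *)
Definition kgibbs of (0 < lam)%R & measurable_fun setT C &
    (forall p, 0 <= C p)%R :=
  fun x A => \int[krow k x]_(y in A)
    (gibbs_density lam (krow k x) (fun y => C (x, y)) y)%:E.

Hypotheses (lam_gt0 : (0 < lam)%R) (mC : measurable_fun setT C)
  (C_ge0 : forall p, (0 <= C p)%R).

Local Notation K := (kgibbs lam_gt0 mC C_ge0).

Let mC1 x : measurable_fun setT (fun y => C (x, y)).
Proof. exact: measurable_fun_pair2. Qed.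

Let K0 x : K x set0 = 0.
Proof. exact: integral_set0. Qed.

Let K_ge0 x A : 0 <= K x A.
Proof. by apply: integral_ge0 => y _; rewrite lee_fin expR_ge0. Qed.

Let K_sigma_additive x : semi_sigma_additive (K x).
Proof.
move=> F mF tF mUF; rewrite /kgibbs ge0_integral_bigcup//.
- apply: is_cvg_nneseries_cond => n _ _.
  by apply: integral_ge0 => y _; rewrite lee_fin expR_ge0.
- exact/measurable_EFinP/measurable_funTS/measurable_gibbs_density.
- by move=> y _; rewrite lee_fin expR_ge0.
Qed.

HB.instance Definition _ x := isMeasure.Build _ _ _ (K x) (K0 x) (K_ge0 x)
  (@K_sigma_additive x).

Definition kgibbs_measure : X -> {measure set Y -> \bar R} := K.

(* With an indicator inside, this is the integral of a jointly measurable
   function against the kernel. *)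
Let K_measurable A : measurable A -> measurable_fun setT (kgibbs_measure ^~ A).
Proof.
move=> mA; rewrite /kgibbs_measure /kgibbs.
pose h (p : X * Y) := (expR (lam * (free_energy lam (krow k p.1)
  (fun y => C (p.1, y)) - C p)) * \1_A p.2)%:E.
rewrite (_ : (fun _ => _) = (fun x => \int[k x]_y h (x, y))); last first.
  apply/funext => x; rewrite -[RHS]krow_integral [LHS]integral_mkcond.
  apply: eq_integral => y _; rewrite /h /patch indicE /=.
  by case: ifPn; rewrite ?mulr1 ?mulr0.
apply: measurable_fun_integral_finite_kernel.
- by move=> p; rewrite /h lee_fin mulr_ge0// ?expR_ge0//.
- apply/measurable_EFinP; apply: measurable_funM.
    apply: measurableT_comp => //; apply: measurable_funM => //.
    apply: measurable_funB => //.
    exact: (measurableT_comp (measurable_free_energy lam k mC)).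
  exact: (measurableT_comp (measurable_indic mA)).
Qed.

HB.instance Definition _ := isKernel.Build _ _ _ _ _ kgibbs_measure
  K_measurable.

Let K_setT x : kgibbs_measure x setT = 1.
Proof. exact: integral_gibbs_density. Qed.

HB.instance Definition _ := Kernel_isProbability.Build _ _ _ _ _ kgibbs_measure
  K_setT.

Definition gibbs_kernel : R.-pker X ~> Y := kgibbs_measure.

Lemma gibbs_kernelE x A : krow gibbs_kernel x A = \int[krow k x]_(y in A)
  (gibbs_density lam (krow k x) (fun y => C (x, y)) y)%:E.
Proof. by []. Qed.

End gibbs_kernel.
(** * Integration along trajectories *)

(** When s is infinite, so are both sides. Divergences enter the cost of a
    trajectory as such constants s, and the remaining cost g is known to be
    measurable only where they are finite. *)
Lemma prob_integral_addl d (Y : measurableType d) (R : realType)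
    (P : {measure set Y -> \bar R}) (s : \bar R) (g : Y -> \bar R) :
  P setT = 1 -> 0 <= s -> (forall y, 0 <= g y) ->
  (s < +oo -> measurable_fun setT g) ->
  \int[P]_y (s + g y) = s + \int[P]_y g y.
Proof.
move=> PT s0 g0 mg.
have [soo|] := ltP s +oo; last first.
  rewrite leye_eq => /eqP ->; rewrite addye; last first.
    by rewrite -ltNye (@lt_le_trans _ _ 0)// integral_ge0.
  under eq_integral do rewrite addye -?ltNye ?(lt_le_trans _ (g0 _))//.
  by rewrite integral_cst// PT mule1.
rewrite ge0_integralD//; last exact: mg.
by rewrite integral_cst// PT mule1.
Qed.

Section trajectory_integral.
Context dX dU (X : measurableType dX) (U : measurableType dU) (R : realType).
Variables (pi : policies X U R) (tau : transitions X U R).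

Definition tcons n (u : U) (y : X) (w : n.-tuple (U * X)%type) :
  n.+1.-tuple (U * X)%type := [tuple of (u, y) :: w].

Lemma traj0_integral t x (f : 0.-tuple (U * X)%type -> \bar R) :
  measurable_fun setT f -> \int[traj pi tau t 0 x]_w f w = f [tuple].
Proof. by move=> mf; rewrite /= integral_dirac// diracT mul1e. Qed.

Lemma traj_integral t n x (f : n.+1.-tuple (U * X)%type -> \bar R) :
  (forall w, 0 <= f w) -> measurable_fun setT f ->
  \int[traj pi tau t n.+1 x]_w f w =
  \int[pi t x]_u \int[tau t (x, u)]_y
    \int[traj pi tau t.+1 n y]_w f (tcons u y w).
Proof.
move=> f0 mf; rewrite [LHS]integral_kcomp//.
apply: eq_integral => u _; rewrite [LHS]integral_kcomp//.
apply: eq_integral => y _; rewrite [LHS]integral_kcomp//.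
apply: eq_integral => w _.
by rewrite integral_dirac// diracT mul1e.
Qed.

Lemma measurable_tcons_tail n u : measurable_fun setT
  (fun q : X * n.-tuple (U * X)%type => tcons u q.1 q.2).
Proof.
apply: measurable_cons => //.
exact: measurable_fun_pair.
Qed.

Lemma measurable_tcons n : measurable_fun setT
  (fun q : (U * X) * n.-tuple (U * X)%type => tcons q.1.1 q.1.2 q.2).
Proof.
apply: measurable_cons => //; rewrite [X in measurable_fun _ X](_ : _ = fst)//.
by apply/funext => -[[u y] w].
Qed.

Lemma state0 x n (w : n.-tuple (U * X)%type) : state x w 0 = x.
Proof. by []. Qed.

(** The default states differ on the two sides, hence the bound on k. *)
Lemma stateS x n u y (w : n.-tuple (U * X)%type) k : (k <= n)%N ->
  state x (tcons u y w) k.+1 = state y w k.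
Proof.
move=> kn; rewrite /state /=; apply: set_nth_default.
by rewrite /= size_map size_tuple.
Qed.

Lemma action0 n u y (w : n.-tuple (U * X)%type) : action (tcons u y w) ord0 = u.
Proof. by []. Qed.

Lemma actionS n u y (w : n.-tuple (U * X)%type) k :
  action (tcons u y w) (lift ord0 k) = action w k.
Proof. by rewrite /action tnthS. Qed.

Lemma measurable_state x n k :
  measurable_fun setT (fun w : n.-tuple (U * X)%type => state x w k).
Proof.
case: k => [|k]; first exact: measurable_cst.
have [kn|nk] := ltnP k n; last first.
  rewrite (_ : (fun _ => _) = cst x); first exact: measurable_cst.
  apply/funext => w; rewrite /state nth_default//= size_map size_tuple//.
rewrite (_ : (fun _ => _) = (fun w => (tnth w (Ordinal kn)).2)).
  apply: (measurableT_comp measurable_snd).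
  exact: measurable_tnth.
apply/funext => w.
rewrite /state /= (nth_map (tnth w (Ordinal kn))) ?size_tuple//.
by rewrite -(tnth_nth _ w (Ordinal kn)).
Qed.

Lemma measurable_action n k :
  measurable_fun setT (fun w : n.-tuple (U * X)%type => action w k).
Proof.
rewrite /action; apply: (measurableT_comp measurable_fst).
exact: measurable_tnth.
Qed.

End trajectory_integral.

(** * The soft value function *)

Section soft_control.
Context dX dU (X : measurableType dX) (U : measurableType dU) (R : realType).
Variables (lam : R) (c : nat -> X * U -> R) (cT : X -> R).
Variables (rho : policies X U R) (iota : transitions X U R).
Hypotheses (lam_gt0 : (0 < lam)%R)
  (c_ge0 : forall t p, (0 <= c t p)%R) (cT_ge0 : forall x, (0 <= cT x)%R)
  (mc : forall t, measurable_fun [set: X * U] (c t))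
  (mcT : measurable_fun [set: X] cT).

(** One stage of the recursion over the next state, with continuation value
    v; kept generic in v so that [soft_value] is a structural recursion. *)
Definition backup (t : nat) (v : X -> R) (p : X * U) : R :=
  free_energy lam (krow (iota t) p) (fun y => (c t p + v y)%R).

(** [soft_value t n] is the value at time t when n stages remain. *)
Fixpoint soft_value (t n : nat) (x : X) : R :=
  if n is n'.+1 then
    free_energy lam (krow (rho t) x)
      (fun u => backup t (soft_value t.+1 n') (x, u))
  else cT x.

Definition soft_Q (t n : nat) : X * U -> R := backup t (soft_value t.+1 n).

Lemma soft_valueS t n x : soft_value t n.+1 x =
  free_energy lam (krow (rho t) x) (fun u => soft_Q t n (x, u)).
Proof. by []. Qed.

Definition stage_cost (t : nat) (v : X -> R) (q : X * U * X) : R :=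
  (c t q.1 + v q.2)%R.

Lemma measurable_stage_cost t v : measurable_fun setT v ->
  measurable_fun setT (stage_cost t v).
Proof.
move=> mv; apply: measurable_funD.
  exact: (measurableT_comp (mc t)).
exact: (measurableT_comp mv).
Qed.

(** Measurability and sign are proved together: the value with n + 1 stages
    left is a free energy, whose measurability in the state and whose sign
    come from those of its cost, the value with n stages left. *)
Lemma soft_value_regular n t :
  measurable_fun setT (soft_value t n) /\ forall x, (0 <= soft_value t n x)%R.
Proof.
elim: n t => [|n IHn] t //=.
have [mv v0] := IHn t.+1.
have mQ : measurable_fun setT (soft_Q t n).
  exact: (measurable_free_energy lam (iota t) (measurable_stage_cost t mv)).
split; first exact: (measurable_free_energy lam (rho t) mQ).
move=> x; apply: free_energy_ge0 => //.
- exact: measurable_fun_pair2.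
- move=> u; apply: free_energy_ge0 => //.
    by apply: measurable_funD => //; exact: measurable_cst.
  by move=> y; rewrite addr_ge0.
Qed.

Lemma measurable_soft_value t n : measurable_fun setT (soft_value t n).
Proof. by have [] := soft_value_regular n t. Qed.

Lemma soft_value_ge0 t n x : (0 <= soft_value t n x)%R.
Proof. by have [_] := soft_value_regular n t. Qed.

Lemma measurable_soft_Q t n : measurable_fun setT (soft_Q t n).
Proof.
exact: (measurable_free_energy lam (iota t)
  (measurable_stage_cost t (measurable_soft_value _ _))).
Qed.

Let mnext t n p : measurable_fun setT
  (fun y => (c t p + soft_value t.+1 n y)%R).
Proof.
by apply: measurable_funD => //; exact: measurable_soft_value.
Qed.

Let next_ge0 t n p y : (0 <= c t p + soft_value t.+1 n y)%R.
Proof. by rewrite addr_ge0// soft_value_ge0. Qed.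

Lemma soft_Q_ge0 t n p : (0 <= soft_Q t n p)%R.
Proof. exact: free_energy_ge0. Qed.

Let mQ1 t n x : measurable_fun setT (fun u => soft_Q t n (x, u)).
Proof. by apply: measurable_fun_pair2; exact: measurable_soft_Q. Qed.

(** * The path integral formula *)

Lemma path_costS t n x u y (w : n.-tuple (U * X)%type) :
  path_cost c cT t x (tcons u y w) =
  (c t (x, u) + path_cost c cT t.+1 y w)%R.
Proof.
rewrite /path_cost big_ord_recl addn0 stateS// -addrA; congr (_ + (_ + _))%R.
apply: eq_bigr => k _; rewrite actionS lift0 stateS 1?ltnW//.
by rewrite addnS addSn.
Qed.

Lemma measurable_path_cost t n x : measurable_fun setT
  (fun w : n.-tuple (U * X)%type => path_cost c cT t x w).
Proof.
apply: measurable_funD; last first.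
  by apply: measurableT_comp => //; exact: measurable_state.
apply: measurable_sum => k; apply: measurableT_comp => //.
apply: measurable_fun_pair.
- exact: measurable_state.
- exact: measurable_action.
Qed.

Lemma expR_soft_Q t n p : (expR (- (lam * soft_Q t n p)))%:E =
  (expR (- (lam * c t p)))%:E *
  \int[iota t p]_y (expR (- (lam * soft_value t.+1 n y)))%:E.
Proof.
rewrite expR_free_energy// krow_integral -ge0_integralZl//; last first.
  by apply/measurable_EFinP/measurable_expRN/measurable_soft_value.
by apply: eq_integral => y _; rewrite -EFinM -expRD mulrDr opprD.
Qed.

(** The two free energies of a stage turn into integrals against rho and
    iota, and the stage cost into a factor that goes under the trajectory
    integral. *)
Lemma soft_value_path_integral n t x : (expR (- (lam * soft_value t n x)))%:E =
  \int[traj rho iota t n x]_w (expR (- (lam * path_cost c cT t x w)))%:E.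
Proof.
have mf k s y : measurable_fun setT (fun w : k.-tuple (U * X)%type =>
    (expR (- (lam * path_cost c cT s y w)))%:E).
  apply/measurable_EFinP; apply: measurable_expRN.
  exact: measurable_path_cost.
elim: n t x => [|n IHn] t x.
  by rewrite traj0_integral// /path_cost big_ord0 add0r.
rewrite soft_valueS expR_free_energy//; last by move=> u; exact: soft_Q_ge0.
rewrite krow_integral traj_integral//.
apply: eq_integral => u _; rewrite expR_soft_Q -ge0_integralZl//; last first.
  by apply/measurable_EFinP/measurable_expRN/measurable_soft_value.
apply: eq_integral => y _; rewrite IHn -ge0_integralZl//; last exact: mf.
apply: eq_integral => w _.
by rewrite path_costS -EFinM -expRD -opprD -mulrDr.
Qed.

(** * The lower bound on regularised costs *)

Section step.
Variables (pi : policies X U R) (tau : transitions X U R).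
Local Notation J := (reg_path_cost lam c cT rho iota pi tau).

Definition policy_penalty t x : \bar R :=
  (lam^-1)%:E * KL (krow (pi t) x) (krow (rho t) x).

Definition transition_penalty t p : \bar R :=
  (lam^-1)%:E * KL (krow (tau t) p) (krow (iota t) p).

Lemma policy_penalty_ge0 t x : 0 <= policy_penalty t x.
Proof. by apply: mule_ge0; rewrite ?KL_ge0// lee_fin invr_ge0 ltW. Qed.

Lemma transition_penalty_ge0 t p : 0 <= transition_penalty t p.
Proof. by apply: mule_ge0; rewrite ?KL_ge0// lee_fin invr_ge0 ltW. Qed.

Lemma reg_path_costE t n x (w : n.-tuple (U * X)%type) : J t x w =
  (cT (state x w n))%:E + \sum_(k < n)
    ((c (t + k) (state x w k, action w k))%:E
     + policy_penalty (t + k) (state x w k)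
     + transition_penalty (t + k) (state x w k, action w k)).
Proof. by []. Qed.

Lemma reg_path_cost_ge0 t n x (w : n.-tuple (U * X)%type) : 0 <= J t x w.
Proof.
rewrite reg_path_costE adde_ge0 ?lee_fin// sume_ge0// => k _.
by rewrite !adde_ge0 ?lee_fin ?policy_penalty_ge0 ?transition_penalty_ge0.
Qed.

Lemma reg_path_costS t n x u y (w : n.-tuple (U * X)%type) :
  J t x (tcons u y w) =
  policy_penalty t x +
  (((c t (x, u))%:E + transition_penalty t (x, u)) + J t.+1 y w).
Proof.
rewrite !reg_path_costE big_ord_recl addn0 stateS//.
rewrite [X in _ + (_ + X) = _](_ : _ = \sum_(k < n)
    ((c (t.+1 + k) (state y w k, action w k))%:E
     + policy_penalty (t.+1 + k) (state y w k)
     + transition_penalty (t.+1 + k) (state y w k, action w k))); last first.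
  apply: eq_bigr => k _; rewrite actionS lift0 stateS 1?ltnW//.
  by rewrite addnS addSn.
by rewrite state0 action0 addeCA -!addeA addeCA; do 3 congr (_ + _).
Qed.

Definition expected_cost t n (y : X) : \bar R :=
  \int[traj pi tau t n y]_w J t y w.

Lemma expected_cost_ge0 t n y : 0 <= expected_cost t n y.
Proof. by apply: integral_ge0 => w _; exact: reg_path_cost_ge0. Qed.

(** The expected cost from x at time t given the action u, without the
    divergence of the policy at x, which is the same for all actions. *)
Definition action_cost t n x u : \bar R :=
  ((c t (x, u))%:E + transition_penalty t (x, u)) +
  \int[tau t (x, u)]_y expected_cost t.+1 n y.

Let stage_ge0 t p : 0 <= (c t p)%:E + transition_penalty t p.
Proof. by rewrite adde_ge0 ?lee_fin ?transition_penalty_ge0. Qed.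

Lemma action_cost_ge0 t n x u : 0 <= action_cost t n x u.
Proof.
by rewrite adde_ge0// integral_ge0// => y _; exact: expected_cost_ge0.
Qed.

Section measurable_cost.
Variables (t n : nat) (x : X).
Hypothesis mJ :
  measurable_fun setT (fun w : n.+1.-tuple (U * X)%type => J t x w).

(** For fixed x and u the cost of a trajectory and that of its tail differ by
    a constant, which can be subtracted when it is finite. *)
Lemma measurable_reg_path_cost_tail u :
  policy_penalty t x < +oo -> transition_penalty t (x, u) < +oo ->
  measurable_fun setT (fun q : X * n.-tuple (U * X)%type => J t.+1 q.1 q.2).
Proof.
move=> aoo boo.
have afin : policy_penalty t x \is a fin_num.
  by rewrite ge0_fin_numE ?policy_penalty_ge0.
have bfin : (c t (x, u))%:E + transition_penalty t (x, u) \is a fin_num.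
  by rewrite ge0_fin_numE// lte_add_pinfty// ltry.
rewrite (_ : (fun q => _) = (fun q =>
    (J t x (tcons u q.1 q.2) - policy_penalty t x)
    - ((c t (x, u))%:E + transition_penalty t (x, u)))).
  apply: emeasurable_funB => //; apply: emeasurable_funB => //.
  exact: (measurableT_comp mJ (measurable_tcons_tail u)).
apply/funext => -[y w] /=; rewrite reg_path_costS.
by rewrite [X in X - _ - _]addeC addeK// [X in X - _]addeC addeK.
Qed.

Lemma measurable_expected_cost u :
  policy_penalty t x < +oo -> transition_penalty t (x, u) < +oo ->
  measurable_fun setT (expected_cost t.+1 n).
Proof.
move=> aoo boo; apply: (measurable_fun_integral_finite_kernel
  (fun q : X * n.-tuple (U * X)%type => J t.+1 q.1 q.2)).
- by move=> q; exact: reg_path_cost_ge0.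
- exact: measurable_reg_path_cost_tail aoo boo.
Qed.

Lemma tail_costE u :
  \int[tau t (x, u)]_y \int[traj pi tau t.+1 n y]_w J t x (tcons u y w) =
  policy_penalty t x + action_cost t n x u.
Proof.
have fin :
    policy_penalty t x +
      ((c t (x, u))%:E + transition_penalty t (x, u)) < +oo ->
    policy_penalty t x < +oo /\ transition_penalty t (x, u) < +oo.
  move=> soo; split; apply: le_lt_trans soo; first by rewrite leeDl.
  by rewrite addeA leeDr// adde_ge0 ?lee_fin ?policy_penalty_ge0.
rewrite /action_cost addeA -prob_integral_addl//; last 4 first.
- exact: prob_kernel.
- by rewrite adde_ge0// policy_penalty_ge0.
- exact: expected_cost_ge0.
- by move=> /fin [aoo boo]; exact: measurable_expected_cost aoo boo.
apply: eq_integral => y _.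
under eq_integral do rewrite reg_path_costS addeA.
rewrite prob_integral_addl//.
- exact: prob_kernel.
- by rewrite adde_ge0// policy_penalty_ge0.
- exact: reg_path_cost_ge0.
- move=> /fin [aoo boo].
  by apply: measurable_fun_pair2 (measurable_reg_path_cost_tail aoo boo).
Qed.

(** The divergence of the transition at (x, u) is not known to be measurable
    in u; the action cost is, being an integral of the total cost up to a
    constant. *)
Lemma measurable_action_cost : policy_penalty t x < +oo ->
  measurable_fun setT (action_cost t n x).
Proof.
move=> aoo.
have afin : policy_penalty t x \is a fin_num.
  by rewrite ge0_fin_numE ?policy_penalty_ge0.
rewrite (_ : action_cost t n x = (fun u =>
  (\int[tau t (x, u)]_y \int[traj pi tau t.+1 n y]_w J t x (tcons u y w))
   - policy_penalty t x)); last first.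
  by apply/funext => u; rewrite tail_costE [X in X - _]addeC addeK.
apply: emeasurable_funB => //.
pose g (q : U * X) := \int[traj pi tau t.+1 n q.2]_w J t x (tcons q.1 q.2 w).
have g0 q : 0 <= g q.
  by apply: integral_ge0 => w _; exact: reg_path_cost_ge0.
have mg : measurable_fun setT g.
  apply: (measurable_fun_integral_finite_kernel
    (fun q : U * X * n.-tuple (U * X)%type => J t x (tcons q.1.1 q.1.2 q.2))
    (kcomap (traj pi tau t.+1 n) (@measurable_snd _ _ U X))).
  - by move=> q; exact: reg_path_cost_ge0.
  - exact: (measurableT_comp mJ (@measurable_tcons _ _ _ _ n)).
apply: (measurable_fun_integral_finite_kernel
  (fun q : U * X => g q) (kcomap (tau t) (pair1_measurable x))) => //.
Qed.

(** The Bellman recursion of arbitrary policies and transitions, infinite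
    costs included. *)
Lemma expected_costS : expected_cost t n.+1 x =
  policy_penalty t x + \int[pi t x]_u action_cost t n x u.
Proof.
rewrite /expected_cost traj_integral//; last exact: reg_path_cost_ge0.
under eq_integral do rewrite tail_costE.
rewrite prob_integral_addl//.
- exact: prob_kernel.
- exact: policy_penalty_ge0.
- exact: action_cost_ge0.
- exact: measurable_action_cost.
Qed.

End measurable_cost.
Lemma soft_Q_le t n x u :
  (forall y, (soft_value t.+1 n y)%:E <= expected_cost t.+1 n y) ->
  measurable_fun setT (expected_cost t.+1 n) ->
  (soft_Q t n (x, u))%:E <= action_cost t n x u.
Proof.
move=> le_exp mexp.
apply: (le_trans (free_energy_le _ lam_gt0 (mnext t n (x, u))
  (next_ge0 t n (x, u)) (krow (tau t) (x, u)))).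
have mV : measurable_fun setT (fun y => (soft_value t.+1 n y)%:E).
  exact/measurable_EFinP/measurable_soft_value.
have V0 y : 0 <= (soft_value t.+1 n y)%:E by rewrite lee_fin soft_value_ge0.
rewrite krow_integral; under eq_integral do rewrite EFinD.
rewrite prob_integral_addl;
  [|exact: prob_kernel|by rewrite lee_fin|exact: V0|by []].
rewrite /action_cost addeAC; apply: leeD2l.
exact: ge0_le_integral.
Qed.

(** Backward induction: at each stage [expected_costS] exhibits the cost as
    one entropy-regularised problem over actions whose cost is itself bounded
    below by one over next states. An infinite divergence makes the
    right-hand side infinite; when the divergences are finite the tail cost
    is measurable and the induction hypothesis applies to it. *)
Lemma soft_value_le n t x :
  measurable_fun setT (fun w : n.-tuple (U * X)%type => J t x w) ->
  (soft_value t n x)%:E <= expected_cost t n x.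
Proof.
elim: n t x => [|n IHn] t x mJ.
  rewrite /expected_cost traj0_integral//.
  by rewrite reg_path_costE big_ord0 adde0.
rewrite expected_costS//.
have [aoo|] := ltP (policy_penalty t x) +oo; last first.
  rewrite leye_eq => /eqP ->; rewrite addye ?leey//.
  rewrite -ltNye (@lt_le_trans _ _ 0)// integral_ge0// => u _.
  exact: action_cost_ge0.
apply: (le_trans (free_energy_le _ lam_gt0 (mQ1 t n x)
  (fun u => soft_Q_ge0 t n (x, u)) (krow (pi t) x))).
rewrite krow_integral addeC; apply: leeD2l.
apply: ge0_le_integral => //.
- by move=> u _; rewrite lee_fin soft_Q_ge0.
- exact/measurable_EFinP.
- exact: measurable_action_cost.
- move=> u _; have [boo|] := ltP (transition_penalty t (x, u)) +oo; last first.
    rewrite leye_eq /action_cost => /eqP ->; rewrite addey// addye ?leey//.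
    rewrite -ltNye (@lt_le_trans _ _ 0)// integral_ge0// => y _.
    exact: expected_cost_ge0.
  apply: soft_Q_le; last exact: measurable_expected_cost aoo boo.
  move=> y; apply: IHn.
  exact: measurable_fun_pair2 (measurable_reg_path_cost_tail mJ aoo boo).
Qed.

End step.

(** * Attainment by Gibbs kernels *)

(** In contrast with general kernels, the divergence of a Gibbs kernel from
    its reference depends measurably on the row, by the closed form
    [gibbs_KL]. *)
Lemma measurable_gibbs_KL d d' (Z : measurableType d) (Y : measurableType d')
    (k : R.-pker Z ~> Y) (C : Z * Y -> R) (mC : measurable_fun setT C)
    (C_ge0 : forall p, (0 <= C p)%R) :
  measurable_fun setT
    (fun z => KL (krow (gibbs_kernel k lam_gt0 mC C_ge0) z) (krow k z)).
Proof.
pose F z := free_energy lam (krow k z) (fun y => C (z, y)).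
pose I z := \int[gibbs_kernel k lam_gt0 mC C_ge0 z]_y (C (z, y))%:E.
rewrite (_ : (fun z => _) = (fun z => (lam * (F z - fine (I z)))%:E)).
  apply/measurable_EFinP; apply: measurable_funM => //.
  apply: measurable_funB; first exact: measurable_free_energy.
  apply: measurableT_comp => //.
  apply: (measurable_fun_integral_finite_kernel (fun q => (C q)%:E)) => //.
  exact/measurable_EFinP.
apply/funext => z; rewrite -[I z]krow_integral; apply: gibbs_KL => //.
exact: measurable_fun_pair2.
Qed.

Section optimal.
Variable T : nat.

(** At time t there are T - t.+1 stages after the current one. *)
Definition opt_policy : policies X U R := fun t =>
  gibbs_kernel (rho t) lam_gt0 (measurable_soft_Q t (T - t.+1))
    (soft_Q_ge0 t (T - t.+1)).

Lemma stage_cost_ge0 t n q : (0 <= stage_cost t (soft_value t.+1 n) q)%R.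
Proof. by rewrite addr_ge0// soft_value_ge0. Qed.

Definition opt_trans : transitions X U R := fun t =>
  gibbs_kernel (iota t) lam_gt0
    (measurable_stage_cost t (measurable_soft_value t.+1 (T - t.+1)))
    (stage_cost_ge0 t (T - t.+1)).

Lemma opt_policy_optimal t x :
  reg_feasible (fun u => (soft_Q t (T - t.+1) (x, u))%:E) (krow (rho t) x)
    (krow (opt_policy t) x) /\
  reg_cost lam (fun u => (soft_Q t (T - t.+1) (x, u))%:E) (krow (rho t) x)
    (krow (opt_policy t) x) = (soft_value t (T - t.+1).+1 x)%:E.
Proof.
exact: (gibbs_optimal lam_gt0 (mQ1 t (T - t.+1) x)
  (fun u => soft_Q_ge0 t _ (x, u)) (fun A _ => gibbs_kernelE _ _ _ _ x A)).
Qed.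

Lemma opt_trans_optimal t p :
  reg_feasible (fun y => (c t p + soft_value t.+1 (T - t.+1) y)%:E)
    (krow (iota t) p) (krow (opt_trans t) p) /\
  reg_cost lam (fun y => (c t p + soft_value t.+1 (T - t.+1) y)%:E)
    (krow (iota t) p) (krow (opt_trans t) p) = (soft_Q t (T - t.+1) p)%:E.
Proof.
exact: (gibbs_optimal lam_gt0 (mnext t (T - t.+1) p)
  (next_ge0 t _ p) (fun A _ => gibbs_kernelE _ _ _ _ p A)).
Qed.

Lemma measurable_reg_path_cost_opt t n x : measurable_fun setT
  (fun w : n.-tuple (U * X)%type =>
    reg_path_cost lam c cT rho iota opt_policy opt_trans t x w).
Proof.
have mp k : measurable_fun setT (policy_penalty opt_policy k).
  by apply: emeasurable_funM => //; exact: measurable_gibbs_KL.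
have mt k : measurable_fun setT (transition_penalty opt_trans k).
  by apply: emeasurable_funM => //; exact: measurable_gibbs_KL.
under eq_fun do rewrite reg_path_costE.
apply: emeasurable_funD.
  apply/measurable_EFinP; apply: measurableT_comp => //.
  exact: measurable_state.
apply: emeasurable_sum => k.
have ms : measurable_fun setT (fun w : n.-tuple (U * X)%type => state x w k).
  exact: measurable_state.
have msa : measurable_fun setT
    (fun w : n.-tuple (U * X)%type => (state x w k, action w k)).
  by apply: measurable_fun_pair => //; exact: measurable_action.
apply: emeasurable_funD; first apply: emeasurable_funD.
- by apply/measurable_EFinP; apply: measurableT_comp.
- exact: (measurableT_comp (mp _) ms).
- exact: (measurableT_comp (mt _) msa).
Qed.

(** Every inequality of the lower bound is an equality along Gibbs kernels. *)
Lemma expected_cost_opt n t x : (t + n)%N = T ->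
  expected_cost opt_policy opt_trans t n x = (soft_value t n x)%:E.
Proof.
elim: n t x => [|n IHn] t x tnT.
  rewrite /expected_cost traj0_integral;
    last exact: measurable_reg_path_cost_opt.
  by rewrite reg_path_costE big_ord0 adde0.
have nE : (T - t.+1)%N = n by rewrite -tnT addnS -addSn addKn.
rewrite expected_costS; last exact: measurable_reg_path_cost_opt.
have [_] := opt_policy_optimal t x; rewrite nE => <-.
rewrite /reg_cost addeC krow_integral; congr (_ + _).
apply: eq_integral => u _.
have [_] := opt_trans_optimal t (x, u); rewrite nE => <-.
rewrite /reg_cost krow_integral.
under [in RHS]eq_integral do rewrite EFinD.
rewrite prob_integral_addl; [|exact: prob_kernel|by rewrite lee_fin
  |by move=> y; rewrite lee_fin soft_value_ge0
  |by move=> _; exact/measurable_EFinP/measurable_soft_value].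
rewrite /action_cost addeAC; congr (_ + _ + _).
by apply: eq_integral => y _; apply: IHn; rewrite addSn -addnS.
Qed.

Lemma opt_control_feasible t x : (t <= T)%N ->
  control_feasible T lam c cT rho iota t x opt_policy opt_trans.
Proof.
move=> tT; split.
- by move=> k y _; have [[]] := opt_policy_optimal k y.
- by move=> k p _; have [[]] := opt_trans_optimal k p.
- apply/integrableP; split; first exact: measurable_reg_path_cost_opt.
  under eq_integral do rewrite gee0_abs ?reg_path_cost_ge0//.
  by rewrite [ltLHS]expected_cost_opt ?subnKC// ltry.
Qed.

Lemma soft_value_attained t x : (t <= T)%N ->
  control_costs T lam c cT rho iota t x (soft_value t (T - t) x)%:E.
Proof.
move=> tT; exists opt_policy, opt_trans; split.
  exact: opt_control_feasible.
by rewrite -(expected_cost_opt _ (subnKC tT)).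
Qed.

(** * Value functions and optimal policies *)

Lemma valueE t x : (t <= T)%N ->
  value T lam c cT rho iota t x = (soft_value t (T - t) x)%:E.
Proof.
rewrite leq_eqVlt => /predU1P[->|tT].
  by rewrite /value ltnn subnn.
rewrite /value tT; apply/eqP; rewrite eq_le; apply/andP; split.
  by apply: ereal_inf_lbound; apply: soft_value_attained; exact: ltnW.
apply: le_ereal_inf_tmp => _ [pi [tau [[_ _ iJ] ->]]].
by apply: soft_value_le; exact: measurable_int iJ.
Qed.

Lemma next_costE t p : (t < T)%N ->
  next_cost T lam c cT rho iota t p =
  (fun y => (c t p + soft_value t.+1 (T - t.+1) y)%:E).
Proof. by move=> tT; apply/funext => y; rewrite /next_cost valueE. Qed.

Lemma soft_Q_attained t p : (t < T)%N ->
  reg_costs lam (next_cost T lam c cT rho iota t p) (krow (iota t) p)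
    (soft_Q t (T - t.+1) p)%:E.
Proof.
move=> tT; rewrite next_costE//; exists (krow (opt_trans t) p);
  by have [] := opt_trans_optimal t p.
Qed.

Lemma QfunE t p : (t < T)%N ->
  Qfun T lam c cT rho iota t p = (soft_Q t (T - t.+1) p)%:E.
Proof.
move=> tT; apply/eqP; rewrite eq_le; apply/andP; split.
  exact/ereal_inf_lbound/soft_Q_attained.
apply: le_ereal_inf_tmp => _ [mu _ <-]; rewrite next_costE//.
exact: free_energy_le (mnext _ _ _) (next_ge0 _ _ _) _.
Qed.

Lemma zfunE t x : (t <= T)%N ->
  zfun T lam c cT rho iota t x = (expR (- (lam * soft_value t (T - t) x)))%:E.
Proof. by move=> tT; rewrite /zfun valueE. Qed.

Lemma opt_policy_is_optimal t : (t < T)%N ->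
  optimal_policy T lam c cT rho iota t (opt_policy t).
Proof.
move=> tT x.
rewrite (_ : (fun u => _) =
    (fun u => (soft_Q t (T - t.+1) (x, u))%:E)); last first.
  by apply/funext => u; rewrite QfunE.
have [feas costE] := opt_policy_optimal t x; split => // mu _.
rewrite costE; exact: free_energy_le (mQ1 _ _ _) (fun=> soft_Q_ge0 _ _ _) _.
Qed.

(** An optimal policy is the Gibbs measure of the stage problem, and its
    density exp(lam V_t) exp(- lam Q_t) is r_t E[z_{t+1}] / z_t by
    [expR_soft_Q]. *)
Lemma optimal_policyE t pistar x A : (t < T)%N ->
  optimal_policy T lam c cT rho iota t pistar -> measurable A ->
  pistar x A = \int[rho t x]_(u in A)
    ((rfun lam c t (x, u))%:E *
     (\int[iota t (x, u)]_y zfun T lam c cT rho iota t.+1 y) /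
     zfun T lam c cT rho iota t x).
Proof.
move=> tT /(_ x); rewrite (_ : (fun u => Qfun _ _ _ _ _ _ _ _) =
    (fun u => (soft_Q t (T - t.+1) (x, u))%:E)); last first.
  by apply/funext => u; rewrite QfunE.
move=> [feas minimal] mA.
have [feas' costE] := opt_policy_optimal t x.
have := minimal _ feas'; rewrite costE => le_cost.
rewrite -[LHS]/(krow pistar x A).
rewrite (gibbs_unique lam_gt0 (mQ1 t _ x) _ feas le_cost)//; last first.
  by move=> u; exact: soft_Q_ge0.
rewrite krow_integral; apply: eq_integral => u _.
have zE : zfun T lam c cT rho iota t x =
    (expR (- (lam * soft_value t (T - t.+1).+1 x)))%:E.
  by rewrite (subnSK tT); apply: zfunE; exact: ltnW.
have QE : (expR (- (lam * soft_Q t (T - t.+1) (x, u))))%:E =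
    (rfun lam c t (x, u))%:E *
    \int[iota t (x, u)]_y zfun T lam c cT rho iota t.+1 y.
  rewrite expR_soft_Q; congr (_ * _).
  by apply: eq_integral => y _; rewrite zfunE.
rewrite zE -QE inver gt_eqF ?expR_gt0//.
rewrite gibbs_densityE -EFinM mulrC.
by congr (_ * _)%:E; rewrite -[in RHS]expRN opprK.
Qed.

End optimal.
End soft_control.

Theorem mainTheorem6 (R : realType) (dX dU : measure_display)
  (X : measurableType dX) (U : measurableType dU)
  (T : nat) (lam : R) (c : nat -> X * U -> R) (cT : X -> R)
  (rho : policies X U R) (iota : transitions X U R)
  (lam_gt0 : (0 < lam)%R)
  (c_ge0 : forall t p, (0 <= c t p)%R) (cT_ge0 : forall x, (0 <= cT x)%R)
  (mc : forall t, measurable_fun [set: X * U] (c t))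
  (mcT : measurable_fun [set: X] cT) :
  let V := value T lam c cT rho iota in
  let Q := Qfun T lam c cT rho iota in
  let z := zfun T lam c cT rho iota in
  let r := rfun lam c in
  forall t, (t < T)%N ->
  (* the minima that define V_t and Q_t are attained *)
  (forall x, control_costs T lam c cT rho iota t x (V t x)) /\
  (forall p, reg_costs lam (next_cost T lam c cT rho iota t p)
               (krow (iota t) p) (Q t p)) /\
  (forall x, z t x = \int[traj rho iota t (T - t) x]_w
                       (expR (- (lam * path_cost c cT t x w)))%:E) /\
  (exists pistar : R.-pker X ~> U,
     optimal_policy T lam c cT rho iota t pistar) /\
  (forall pistar : R.-pker X ~> U,
     optimal_policy T lam c cT rho iota t pistar ->
     forall x (A : set U), measurable A ->
       pistar x A = \int[rho t x]_(u in A)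
         ((r t (x, u))%:E * (\int[iota t (x, u)]_y z t.+1 y) / z t x)).
Proof.
move=> V Q z r t tT; have tT' := ltnW tT.
split; last split; last split; last split.
- by move=> x; rewrite /V valueE//; exact: soft_value_attained.
- by move=> p; rewrite /Q QfunE//; exact: soft_Q_attained.
- by move=> x; rewrite /z zfunE// soft_value_path_integral.
- by eexists; exact: opt_policy_is_optimal.
- by move=> pistar opt x A mA; exact: optimal_policyE.
Qed.
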